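(* (Monotonicity rule.) Let $L$ be a frame, let $(P;e)$ be an $L$-complete lattice and $f,g:(P;e)\to(P;e)$ monotone maps such that $\sqcap S_f=a$ and $\sqcap S_g=b$, where $S_f,S_g:P\to L$ are given by $S_f(x)=e(f(x),x)$ and $S_g(x)=e(g(x),x)$. Then $\bigwedge_{y\in P}e(f(y),g(y))\le e(a,b)$.
   Context: A frame is a complete lattice $L$ (with bottom $0$, top $1$) satisfying $a\wedge\bigvee S=\bigvee_{s\in S}(a\wedge s)$ for all $a\in L$, $S\subseteq L$; its relative pseudocomplement is $a\to b=\bigvee\{x\in L\mid a\wedge x\le b\}$. $L^P$ is the set of all maps $P\to L$. An $L$-ordered set is a pair $(P;e)$ with $P$ a set and $e:P\times P\to L$ a map such that for all $x,y,z\in P$: (E1) $e(x,x)=1$; (E2) $e(x,y)\wedge e(y,z)\le e(x,z)$; (E3) $e(x,y)=e(y,x)=1$ implies $x=y$. For $S\in L^P$, an element $x_0\in P$ is the join of $S$, written $x_0=\sqcup S$, if for all $x\in P$: $S(x)\le e(x,x_0)$ and $\bigwedge_{y\in P}(S(y)\to e(y,x))\le e(x_0,x)$. It is the meet, $x_0=\sqcap S$, if for all $x\in P$: $S(x)\le e(x_0,x)$ and $\bigwedge_{y\in P}(S(y)\to e(x,y))\le e(x,x_0)$. Joins and meets are unique when they exist. $(P;e)$ is an $L$-complete lattice if $\sqcup S$ and $\sqcap S$ exist for every $S\in L^P$. A map $f:P\to P$ is monotone if $e(x,y)\le e(f(x),f(y))$ for all $x,y\in P$. *)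

(* Defs.v *)
From HB Require Import structures.
From mathcomp Require Import all_boot all_order.
From mathcomp Require Import boolp classical_sets.

Set Implicit Arguments.
Unset Strict Implicit.
Unset Printing Implicit Defensive.

Import Order.TTheory.

Local Open Scope classical_set_scope.
Local Open Scope order_scope.

HB.mixin Record TBLattice_isComplete d L of Order.TBLattice d L := {
  supremums_neq0 : forall A : set L, supremums A !=set0;
  infimums_neq0 : forall A : set L, infimums A !=set0
}.

#[short(type="completeLatticeType")]
HB.structure Definition CompleteLattice d :=
  {L of TBLattice_isComplete d L & Order.TBLattice d L}.

(* [supremum x0 A] and [infimum x0 A] return x0 on the empty set, hence the
   default values \bot and \top. *)
Definition Sup d (L : completeLatticeType d) (A : set L) : L :=
  supremum \bot A.

Definition Inf d (L : completeLatticeType d) (A : set L) : L :=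
  infimum \top A.

Notation "\Inf_ ( y : T ) F" := (Inf (range (fun y : T => F%O)))
  (at level 41, F at level 41, y name,
   format "'[' \Inf_ ( y  :  T ) '/  '  F ']'") : order_scope.

HB.mixin Record CompleteLattice_isFrame d L of CompleteLattice d L := {
  meet_Sup : forall (a : L) (A : set L),
    a `&` Sup A = Sup [set a `&` s | s in A]
}.

#[short(type="frameType")]
HB.structure Definition Frame d :=
  {L of CompleteLattice_isFrame d L & CompleteLattice d L}.

Definition imp d (L : frameType d) (a b : L) : L :=
  Sup [set x | a `&` x <= b].

Notation "a ~~> b" := (imp a b)
  (at level 60, right associativity) : order_scope.

Section LOrder.
Context d (L : frameType d) (P : Type) (e : P -> P -> L).

Record lordered : Prop := {
  lordered_refl : forall x, e x x = \top;
  lordered_trans : forall x y z, e x y `&` e y z <= e x z;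
  lordered_anti : forall x y, e x y = \top -> e y x = \top -> x = y
}.

Definition is_ljoin (S : P -> L) (x0 : P) : Prop :=
  forall x, S x <= e x x0 /\ \Inf_(y : P) (S y ~~> e y x) <= e x0 x.

Definition is_lmeet (S : P -> L) (x0 : P) : Prop :=
  forall x, S x <= e x0 x /\ \Inf_(y : P) (S y ~~> e x y) <= e x x0.

Record lcomplete_lattice : Prop := {
  lcomplete_ordered : lordered;
  lcomplete_join : forall S : P -> L, exists x0, is_ljoin S x0;
  lcomplete_meet : forall S : P -> L, exists x0, is_lmeet S x0
}.

Definition lmonotone (f : P -> P) : Prop :=
  forall x y, e x y <= e (f x) (f y).

End LOrder.

Section CompleteLatticeTheory.
Context d (L : completeLatticeType d).
Implicit Types (A : set L) (a : L).

Lemma Sup_supremums A : supremums A (Sup A).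
Proof.
rewrite /Sup /supremum; case: eqP => [->|_].
  by split=> [x []|x _]; rewrite ?le0x.
by have [x Ax] := supremums_neq0 A; case: xgetP => // /(_ x).
Qed.

Lemma Inf_infimums A : infimums A (Inf A).
Proof.
rewrite /Inf /infimum; case: eqP => [->|_].
  by split=> [x []|x _]; rewrite ?lex1.
by have [x Ax] := infimums_neq0 A; case: xgetP => // /(_ x).
Qed.

End CompleteLatticeTheory.

Lemma imp_residuation d (L : frameType d) (a b x : L) :
  (x <= a ~~> b) = (a `&` x <= b).
Proof.
have [ub lub] := Sup_supremums [set x | a `&` x <= b].
apply/idP/idP => [/(leI2 (lexx a))|/ub//].
move=> /le_trans; apply; rewrite /imp meet_Sup.
have [_] := Sup_supremums [set a `&` s | s in [set x | a `&` x <= b]].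
by apply=> _ [s /= ? <-].
Qed.

(* Main.v *)
(* By transitivity [e (f y) (g y) `&` e (g y) y <= e (f y) y], so [S_g] lies
   below [S_f] up to the factor [\Inf_(y : P) e (f y) (g y)]; and taking
   meets reverses that comparison. *)
Require Import Defs.
From mathcomp Require Import all_boot all_order.
From mathcomp Require Import boolp classical_sets.

Import Order.TTheory.

Local Open Scope classical_set_scope.
Local Open Scope order_scope.

(** As a meet, [b] satisfies a greatest-lower-bound condition; at [a] it bounds [e a b] below by the
    infimum of [e (g y) y ~~> e a y]. Residuation ([imp_residuation]) then leaves one inequality for
    each [y], settled by transitivity through [g y]. *)

Lemma Inf_le (d : Order.disp_t) (L : completeLatticeType d) (T : Type)
  (F : T -> L) (y : T) : \Inf_(y : T) F y <= F y.
Proof. by have [lb _] := Inf_infimums (range F); apply: lb; exists y. Qed.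

Lemma le_Inf (d : Order.disp_t) (L : completeLatticeType d) (T : Type)
  (F : T -> L) (x : L) : (forall y, x <= F y) -> x <= \Inf_(y : T) F y.
Proof.
move=> xF; have [_ glb] := Inf_infimums (range F).
by apply: glb => _ [y _ <-].
Qed.

Theorem theorem3p8 (d : Order.disp_t) (L : frameType d)
  (P : Type) (e : P -> P -> L) (he : lcomplete_lattice e)
  (f g : P -> P) (hf : lmonotone e f) (hg : lmonotone e g)
  (a b : P)
  (ha : is_lmeet e (fun x => e (f x) x) a)
  (hb : is_lmeet e (fun x => e (g x) x) b) :
  \Inf_(y : P) e (f y) (g y) <= e a b.
Proof.
have [_ glb] := hb a; apply: le_trans glb; apply: le_Inf => y.
rewrite imp_residuation meetC.
(* Since [a] is a lower bound, [e (f y) y <= e a y], so reaching [e (f y) y] suffices. *)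
have [lb _] := ha y; apply: le_trans lb.
apply: le_trans (lordered_trans (lcomplete_ordered he) (f y) (g y) y).
by rewrite leI2 // (@Inf_le _ _ _ (fun y => e (f y) (g y))).
Qed.
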